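(* Let $1\le m<d$ be integers, and let $\mu$ on $\mathbb{R}^m$ and $\nu$ on $\mathbb{R}^{d-m}$ be positive finite Borel measures without atoms, both of which are frame-spectral measures. For an invertible linear transformation $T:\mathbb{R}^d\to\mathbb{R}^d$ put $V=T(\{\mathbf{0}^m\}\times\mathbb{R}^{d-m})$, a subspace of $\mathbb{R}^d$ of dimension $d-m$, and define $$\nu_T(E)=(\delta_{\mathbf{0}^m}\times\nu)(T^{-1}(E))\quad\text{for Borel } E\subset\mathbb{R}^d,\qquad \rho_T=\mu\times\delta_{\mathbf{0}^{d-m}}+\nu_T .$$ If $V\cap(\mathbb{R}^m\times\{\mathbf{0}^{d-m}\})=\{\mathbf{0}^d\}$, then $\rho_T$ is a frame-spectral measure. Moreover, there exist constants $0<A\le B<\infty$ (independent of $T$) such that for every invertible linear transformation $T$ satisfying $V\cap(\mathbb{R}^m\times\{\mathbf{0}^{d-m}\})=\{\mathbf{0}^d\}$ there exists a frame spectrum $\Lambda_T\subset\mathbb{R}^d$ such that $E(\Lambda_T)=\{e^{2\pi i\langle\lambda,x\rangle}:\lambda\in\Lambda_T\}$ is a Fourier frame for $\rho_T$ with frame bounds $A,B$.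
   Context: $\mathbf{0}^k$ denotes the origin of $\mathbb{R}^k$ and $\delta_{\mathbf{0}^k}$ the Dirac mass there. A finite Borel measure $\rho$ on $\mathbb{R}^n$ is frame-spectral if there are a countable set $\Lambda\subset\mathbb{R}^n$ (called a frame spectrum) and constants $0<A\le B<\infty$ (called frame bounds) with $A\|f\|_{L^2(\rho)}^2\le\sum_{\lambda\in\Lambda}\left|\int f(x)e^{2\pi i\langle\lambda,x\rangle}d\rho(x)\right|^2\le B\|f\|_{L^2(\rho)}^2$ for all $f\in L^2(\rho)$; in that case $\{e^{2\pi i\langle\lambda,x\rangle}\}_{\lambda\in\Lambda}$ is called a Fourier frame for $\rho$. *)

(* Defs.v *)
From HB Require Import structures.
From mathcomp Require Import all_boot all_order all_algebra.
From mathcomp Require Import complex.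
From mathcomp Require Import all_classical all_reals all_analysis.
From mathcomp Require Import measurable_realfun.

Set Implicit Arguments.
Unset Strict Implicit.
Unset Printing Implicit Defensive.

Import Order.TTheory GRing.Theory Num.Theory.
Import numFieldNormedType.Exports.
Import ComplexField.Normc.

Local Open Scope classical_set_scope.
Local Open Scope ring_scope.

(* R^n is 'rV[R]_n, with its Borel sigma-algebra. *)
HB.instance Definition _ (R : realType) (n : nat) :=
  @isMeasurable.Build (sigma_display (@open 'rV[R]_n)) 'rV[R]_n
    <<s @open 'rV[R]_n >> (@sigma_algebra0 _ setT _) (@sigma_algebraC _ _)
    (@sigma_algebra_bigcup _ setT _).

Section borel_vectors.
Context {R : realType}.

Lemma open_measurable_rV n (U : set 'rV[R]_n) : open U -> measurable U.
Proof. by move=> oU; exact: sub_sigma_algebra. Qed.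

Lemma coord_measurable n (i : 'I_n) :
  measurable_fun setT (fun x : 'rV[R]_n => x 0 i).
Proof.
apply: (measurability _ (RGenOpens.measurableE R)).
move=> _ [_ [a [b ->]] <-]; rewrite setTI; apply: open_measurable_rV.
apply: open_comp; last exact: interval_open.
by move=> x _; exact: coord_continuous.
Qed.

Lemma open_rV_bigcup n (U : set 'rV[R]_n) : open U ->
  U = \bigcup_(q in [set q : 'rV[rat]_n * rat |
        ball (map_mx ratr q.1 : 'rV[R]_n) (ratr q.2) `<=` U])
      ball (map_mx ratr q.1 : 'rV[R]_n) (ratr q.2).
Proof.
move=> oU; apply/seteqP; split; last by move=> x [q qU] /qU.
move=> x Ux.
have /nbhs_ballP [e /= e0 eU] : nbhs x U by exact: open_nbhs_nbhs.
have [r] := rat_in_itvoo (divr_gt0 e0 (ltr0n R 2)).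
rewrite in_itv/= => /andP[r0 re].
have h i : exists q : rat, `|ratr q - x 0 i| < ratr r :> R.
  have lt2 : x 0 i - ratr r < x 0 i + ratr r.
    by rewrite ltrD2l gtrN.
  by have [q] := rat_in_itvoo lt2; rewrite in_itv/= => /andP[q1 q2]; exists q;
    rewrite ltr_distl q1 q2.
pose q : 'rV[rat]_n := \row_i projT1 (cid (h i)).
have qx i : `|ratr (q 0 i) - x 0 i| < ratr r by rewrite mxE; case: cid.
exists (q, r) => /=; last first.
  by split => // i j; rewrite mxE ord1; exact: qx.
move=> y [_ qy]; apply: eU; split => // i j; rewrite ord1.
have := qy 0 j; rewrite mxE => yj; rewrite /ball/=.
rewrite -(subrKA (ratr (q 0 j))) (le_lt_trans (ler_normD _ _))//.
rewrite (splitr e) ltrD//; first by rewrite distrC (lt_trans (qx j)).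
exact: lt_trans re.
Qed.

Lemma measurable_rV d (X : measurableType d) n (f : X -> 'rV[R]_n) :
  (forall i, measurable_fun setT (fun x => f x 0 i)) -> measurable_fun setT f.
Proof.
move=> mf; apply: (measurability (@open 'rV[R]_n)) => //.
move=> _ [U oU <-]; rewrite setTI (open_rV_bigcup oU) preimage_bigcup.
rewrite bigcup_mkcond; apply: countable_bigcupT_measurable => [|[q r]].
  exact: countableP.
case: ifPn => // _ /=.
have [r0|r0] := ltP 0 (ratr r : R); last first.
  rewrite (_ : _ @^-1` _ = set0)//; apply/seteqP; split => // x [].
  by rewrite ltNge r0.
rewrite (_ : _ @^-1` _ = \bigcap_(i in [set: 'I_n])
   ((fun x => f x 0 i) @^-1` ball (ratr (q 0 i) : R) (ratr r))).
  apply: fin_bigcap_measurable => // i _; rewrite -[X in measurable X]setTI.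
  by apply: mf => //; apply: open_measurable; exact: ball_open.
apply/seteqP; split => x /=.
  by move=> [_ h] i _; have := h 0 i; rewrite mxE.
by move=> h; split => // i j; rewrite ord1 mxE; exact: h.
Qed.

End borel_vectors.

Section vectors.
Context {R : realType}.

(* Identification of R^m * R^k with R^(m + k). *)
Definition row_pair m k (z : 'rV[R]_m * 'rV[R]_k) : 'rV[R]_(m + k) :=
  row_mx z.1 z.2.

Lemma measurable_row_pair m k : measurable_fun setT (@row_pair m k).
Proof.
apply: measurable_rV => i0; rewrite /row_pair.
case: (split_ordP i0) => j ->.
  under eq_fun do rewrite row_mxEl.
  exact: (measurableT_comp (coord_measurable j) measurable_fst).
under eq_fun do rewrite row_mxEr.
exact: (measurableT_comp (coord_measurable j) measurable_snd).
Qed.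

Section product.
Context {m k : nat}.
Variables (mu : {finite_measure set 'rV[R]_m -> \bar R})
  (nu : {finite_measure set 'rV[R]_k -> \bar R}).

(* The product measure, carried from R^m * R^k to R^(m + k). *)
Definition prod_rV : set 'rV[R]_(m + k) -> \bar R :=
  pushforward (mu \x nu)%E (@row_pair m k).

Let mrow : measurable_fun setT (@row_pair m k).
Proof. exact: measurable_row_pair. Qed.

Let prod_rV0 : prod_rV set0 = 0%E.
Proof. by rewrite /prod_rV /pushforward preimage_set0 measure0. Qed.

Let prod_rV_ge0 A : (0 <= prod_rV A)%E.
Proof. exact: measure_ge0. Qed.

Let prod_rV_sigma_additive : semi_sigma_additive prod_rV.
Proof. exact: measure_semi_sigma_additive. Qed.

HB.instance Definition _ := isMeasure.Build _ _ _ prod_rV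
  prod_rV0 prod_rV_ge0 prod_rV_sigma_additive.

Let prod_rV_fin : fin_num_fun prod_rV.
Proof.
apply: lty_fin_num_fun; rewrite /= /prod_rV /pushforward preimage_setT.
rewrite -setXTT product_measure1E//.
by apply: lte_mul_pinfty => //; rewrite ?fin_num_measure// ltey_eq fin_num_measure.
Qed.

HB.instance Definition _ := Measure_isFinite.Build _ _ _ prod_rV prod_rV_fin.

End product.

Lemma measurable_linear_rV m n (T : {linear 'rV[R]_m -> 'rV[R]_n}) :
  measurable_fun setT T.
Proof.
apply: measurable_rV => i.
have -> : (fun x => T x 0 i) = (fun x => \sum_j x 0 j * lin1_mx T j i).
  by apply/funext => x; rewrite -(mul_rV_lin1 T) mxE.
apply: measurable_sum => j; apply: measurable_funM => //.
exact: coord_measurable.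
Qed.

Section image.
Context {m n : nat}.
Variables (rho : {finite_measure set 'rV[R]_m -> \bar R})
  (T : {linear 'rV[R]_m -> 'rV[R]_n}).

Definition image_rV : set 'rV[R]_n -> \bar R := pushforward rho T.

Let image_rV0 : image_rV set0 = 0%E.
Proof. by rewrite /image_rV /pushforward preimage_set0 measure0. Qed.

Let mT : measurable_fun setT T.
Proof. exact: measurable_linear_rV. Qed.

Let image_rV_ge0 A : (0 <= image_rV A)%E.
Proof. exact: measure_ge0. Qed.

Let image_rV_sigma_additive : semi_sigma_additive image_rV.
Proof. exact: measure_semi_sigma_additive. Qed.

HB.instance Definition _ := isMeasure.Build _ _ _ image_rV
  image_rV0 image_rV_ge0 image_rV_sigma_additive.

Let image_rV_fin : fin_num_fun image_rV.
Proof.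
apply: lty_fin_num_fun; rewrite /= /image_rV /pushforward preimage_setT.
by rewrite ltey_eq fin_num_measure.
Qed.

HB.instance Definition _ := Measure_isFinite.Build _ _ _ image_rV image_rV_fin.

End image.

End vectors.

Section frame_spectral.
Context {R : realType} {n : nat}.
Implicit Types (rho : {finite_measure set 'rV[R]_n -> \bar R})
  (f : 'rV[R]_n -> R[i]).

(* An atom of a Borel measure on R^n is a point of positive mass. *)
Definition atomless rho := forall x : 'rV[R]_n, rho [set x] = 0%E.

Definition dotv (u v : 'rV[R]_n) : R := \sum_i u 0 i * v 0 i.

(* exp(i t) *)
Definition cis (t : R) : R[i] := (cos t +i* sin t)%C.

Definition cintegral rho f : R[i] :=
  ((\int[rho]_x complex.Re (f x)) +i* (\int[rho]_x complex.Im (f x)))%C.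

(* The squared norm of f in L^2(rho); it is +oo when f is measurable but not
   square integrable. *)
Definition sqL2norm rho f : \bar R := (\int[rho]_x (normc (f x) ^+ 2)%:E)%E.

Definition square_integrable rho f :=
  [/\ measurable_fun setT (fun x => complex.Re (f x)),
      measurable_fun setT (fun x => complex.Im (f x)) &
      (sqL2norm rho f < +oo)%E].

(* With a positive sign in the exponential and no conjugation of f. *)
Definition fourier_coef rho f (lambda : 'rV[R]_n) : R[i] :=
  cintegral rho (fun x => f x * cis (2 * pi * dotv lambda x)).

(* The exponentials with frequencies in Lambda form a Fourier frame for rho
   with frame bounds A and B. *)
Definition fourier_frame rho (Lambda : set 'rV[R]_n) (A B : R) :=
  [/\ countable Lambda, 0 < A, A <= B &
      forall f, square_integrable rho f ->
        (A%:E * sqL2norm rho f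
           <= \esum_(lambda in Lambda) (normc (fourier_coef rho f lambda) ^+ 2)%:E
           <= B%:E * sqL2norm rho f)%E].

Definition frame_spectral rho :=
  exists (Lambda : set 'rV[R]_n) (A B : R), fourier_frame rho Lambda A B.

End frame_spectral.

Section rho_T.
Context {R : realType} {m k : nat}.

Definition horizontal : set 'rV[R]_(m + k) :=
  [set row_mx x (0 : 'rV[R]_k) | x in [set: 'rV[R]_m]].

Definition vertical : set 'rV[R]_(m + k) :=
  [set row_mx (0 : 'rV[R]_m) y | y in [set: 'rV[R]_k]].

Variables (mu : {finite_measure set 'rV[R]_m -> \bar R})
  (nu : {finite_measure set 'rV[R]_k -> \bar R})
  (T : {linear 'rV[R]_(m + k) -> 'rV[R]_(m + k)}).

Definition nu_T : {finite_measure set 'rV[R]_(m + k) -> \bar R} :=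
  image_rV (prod_rV \d_(0 : 'rV[R]_m) nu) T.

Definition rho_T : set 'rV[R]_(m + k) -> \bar R :=
  measure_add (prod_rV mu \d_(0 : 'rV[R]_k)) nu_T.

HB.instance Definition _ := Measure.on rho_T.

Let rho_T_fin : fin_num_fun rho_T.
Proof.
by move=> E mE; rewrite /rho_T measure_addE fin_numD !fin_num_measure.
Qed.

HB.instance Definition _ := Measure_isFinite.Build _ _ _ rho_T rho_T_fin.

End rho_T.

(* Main.v *)
Require Import Defs.
From mathcomp Require Import all_boot all_order all_algebra.
From mathcomp Require Import complex.
From mathcomp Require Import all_classical all_reals all_analysis.
From mathcomp Require Import measurable_realfun ring lra.
From mathcomp Require polyrcf.

(** Write the functions of L^2(rho_T) as pairs (f, g) in L^2(mu) x L^2(nu), by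
  restriction to R^m x {0} and to V. As V is transverse to R^m x {0}, the two
  restrictions of a frequency can be prescribed independently, so that the
  coefficients are the numbers f^(u) + g^(v) with (u, v) arbitrary in
  R^m x R^(d-m); only the resulting set of pairs (u, v), which does not
  depend on T, matters.

  Since nu has no atoms, a theorem of Wiener's type makes its Fourier transform
  small at suitable points, which yields a sequence (b_n) of frequencies whose
  exponentials are almost orthogonal in L^2(nu), hence a Bessel sequence with
  bound K = nu(R^(d-m)) + 4. Repeat each frequency u of the frame of mu N times,
  paired with distinct b_n's: the part of mu is then bounded below by
  N A |f|^2, while the part of nu costs at most K |g|^2. Doing the same with mu
  and nu exchanged and taking N large gives both frame inequalities. *)

Import Order.TTheory GRing.Theory Num.Theory.
Import numFieldNormedType.Exports.
Import ComplexField.Normc.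

Local Open Scope classical_set_scope.
Local Open Scope ring_scope.

(** * Kernels of trigonometric averages *)

Section trigonometric_average.
Context {R : realType}.
Implicit Types (s phi : R).

(** Multiplied by [2 * sin (pi * s)], the sum telescopes to a difference of two sines, so it is at
    most [|sin (pi * s)|^-1] in absolute value whatever [M] and [phi] are. *)
Lemma cesaro_cos (s phi : R) (M : nat) : sin (pi * s) != 0 ->
  `|M%:R^-1 * \sum_(t < M) cos (2 * pi * (t%:R * s) - phi)|
    <= (M%:R * `|sin (pi * s)|)^-1.
Proof.
move=> s0.
have tel : 2 * sin (pi * s) * \sum_(t < M) cos (2 * pi * (t%:R * s) - phi) =
    sin (2 * pi * (M%:R * s) - phi - pi * s) - sin (- phi - pi * s).
  elim: M => [|M IH]; first by rewrite big_ord0 !mul0r mulr0 add0r subrr mulr0.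
  rewrite big_ord_recr/= mulrDr IH.
  set u := 2 * pi * (M%:R * s) - phi.
  have -> : 2 * pi * (M.+1%:R * s) - phi - pi * s = u + pi * s.
    by rewrite /u -natr1; ring.
  by rewrite (sinD u (pi * s)) (sinB u (pi * s)); ring.
have {tel}le1 : `|sin (pi * s)| * `|\sum_(t < M) cos (2 * pi * (t%:R * s) - phi)| <= 1.
  rewrite -(ler_pM2l (_ : 0 < 2 :> R))// mulrA mulr1.
  rewrite -[X in X * _ * _](@ger0_norm _ 2)// -!normrM tel.
  rewrite (le_trans (ler_normB _ _))// -[leRHS]/(1 + 1) lerD//.
    by rewrite ler_norml sin_geN1 sin_le1.
  by rewrite ler_norml sin_geN1 sin_le1.
(* For [M = 0] both sides vanish, since the inverse of 0 is 0. *)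
have [->|M0] := posnP M; first by rewrite big_ord0 mulr0 normr0 mul0r invr0.
rewrite normrM ger0_norm ?invr_ge0// invfM ler_wpM2l ?invr_ge0//.
by rewrite -[leRHS]mul1r ler_pdivlMr ?normr_gt0// mulrC.
Qed.

(** The derivative of sin at 0 is 1, so the difference quotient stays within 1/2 of 1 on a punctured
    neighbourhood; the point 0 itself is trivial. *)
Lemma sin_lower : \forall x \near (0 : R), `|x| / 2 <= `|sin x|.
Proof.
have /cvg_ex[l hl] : cvg ((fun h => h^-1 *: (sin (h *: 1 + 0 : R) - sin 0)) @ (0 : R)^').
  exact: derivable_sin.
have l1 : l = 1.
  have <- : 'D_1 sin (0 : R) = 1.
    by have [_ ->] := is_derive_sin (0 : R); rewrite cos0.
  by apply/esym/cvg_lim.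
move: hl => /cvgrPdist_le /(_ (1/2)) /(_ ltac:(lra)).
rewrite l1 near_withinE => H.
near=> x.
have [->|x0] := eqVneq x 0; first by rewrite normr0 mul0r.
have : `|1 - x^-1 *: (sin (x *: 1 + 0) - sin 0)| <= 1/2.
  by move: x0; near: x; apply: filterS H => x; apply.
rewrite sin0 subr0 addr0 /GRing.scale/= mulr1 => h.
have : 1/2 <= `|x^-1 * sin x|.
  have := ler_normD (1 - x^-1 * sin x) (x^-1 * sin x).
  by rewrite subrK normr1 => h2; lra.
rewrite normrM normfV [leRHS]mulrC ler_pdivlMr ?normr_gt0//; lra.
Unshelve. all: by end_near. Qed.

(** Up to sign the leading coefficient is positive. Subtracting [C] from a nonconstant polynomial
    keeps that coefficient, and the value of [p - C] eventually exceeds it. *)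
Lemma poly_norm_pinfty (p : {poly R}) (C : R) : (1 < size p)%N ->
  \forall n \near \oo, C <= `|p.[n%:R]|.
Proof.
wlog lc0 : p / 0 < lead_coef p => [wl sp|sp].
  have [/wl|] := ltP 0 (lead_coef p); first exact.
  rewrite le_eqVlt => /orP[|lc0].
    by rewrite lead_coef_eq0 => /eqP p0; rewrite p0 size_poly0 in sp.
  have := wl (- p); rewrite lead_coefN oppr_gt0 size_polyN => /(_ lc0 sp).
  by apply: filterS => n; rewrite hornerN normrN.
have lcE : lead_coef (p - C%:P) = lead_coef p.
  by rewrite lead_coefDl// size_polyN (leq_ltn_trans (size_polyC_leq1 _)).
have [x0 hx0] : exists n, forall x, x >= n -> (p - C%:P).[x] >= lead_coef (p - C%:P).
  by apply: polyrcf.poly_pinfty_gt_lc; rewrite lcE.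
near=> n.
have : lead_coef p <= (p - C%:P).[n%:R].
  by rewrite -lcE; apply: hx0; near: n; exact: nbhs_infty_ger.
rewrite !hornerE => h; apply: le_trans (ler_norm _); lra.
Unshelve. all: by end_near. Qed.

End trigonometric_average.

(** * Decay of the Fourier transform of an atomless measure *)

Section finite_measure_integral.
Context {d} {T : measurableType d} {R : realType}.
Variable mu : {finite_measure set T -> \bar R}.

Lemma bounded_integrable (f : T -> R) (C : R) : measurable_fun setT f ->
  (forall x, `|f x| <= C) -> mu.-integrable setT (EFin \o f).
Proof.
move=> mf fC; apply: (@le_integrable _ _ _ mu setT measurableT _ (EFin \o cst C)).
- exact/measurable_EFinP.
- by move=> x _; rewrite /= lee_fin (le_trans (fC x))// ler_norm.
- exact: finite_measure_integrable_cst.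
Qed.

Lemma integrable_Rsum (I : Type) (s : seq I) (f : I -> T -> R) :
  (forall i, mu.-integrable setT (EFin \o f i)) ->
  mu.-integrable setT (EFin \o (fun x => \sum_(i <- s) f i x)).
Proof.
move=> h; rewrite (_ : _ \o _ = fun x => \sum_(i <- s) (f i x)%:E)%E; last first.
  by apply/funext => x; rewrite /= sumEFin.
by apply: integrable_sum => // i _; exact: h.
Qed.

Lemma Rintegral_sum (I : Type) (s : seq I) (f : I -> T -> R) :
  (forall i, mu.-integrable setT (EFin \o f i)) ->
  \int[mu]_x (\sum_(i <- s) f i x) = \sum_(i <- s) \int[mu]_x f i x.
Proof.
move=> h; elim: s => [|i s IH].
  rewrite big_nil -[RHS](mul0r (fine (mu setT))) -Rintegral_cst//.
  by apply: eq_Rintegral => x _; rewrite big_nil.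
under eq_Rintegral do rewrite big_cons.
by rewrite RintegralD// ?IH ?big_cons//; exact: integrable_Rsum.
Qed.

Lemma integrable_RZl (f : T -> R) (c : R) : mu.-integrable setT (EFin \o f) ->
  mu.-integrable setT (EFin \o (fun x => c * f x)).
Proof. by move=> h; exact: (integrableZl measurableT c h). Qed.

Lemma integrable_RD (f g : T -> R) : mu.-integrable setT (EFin \o f) ->
  mu.-integrable setT (EFin \o g) ->
  mu.-integrable setT (EFin \o (fun x => f x + g x)).
Proof. by move=> hf hg; exact: (integrableD measurableT hf hg). Qed.

Lemma Rdominated_cvg0 (f : nat -> T -> R) (C : R) :
  (forall n, measurable_fun setT (f n)) -> (forall n x, `|f n x| <= C) ->
  {ae mu, forall x, f n x @[n --> \oo] --> (0 : R)} ->
  \int[mu]_x f n x @[n --> \oo] --> (0 : R).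
Proof.
move=> mf fC f0.
apply: fine_cvg => /=.
have [] := @dominated_convergence _ _ _ mu setT measurableT
  (fun n x => (f n x)%:E) (cst 0%E) (EFin \o cst C).
- by move=> n; exact/measurable_EFinP.
- exact: measurable_cst.
- by apply: filterS f0 => x hx _; apply: cvg_EFin hx; exact: nearW.
- exact: finite_measure_integrable_cst.
- by apply: aeW => x n _; rewrite /= lee_fin.
by move=> _ _; rewrite integral0.
Qed.

End finite_measure_integral.

(** * Inner products and the trigonometric functions built on them *)

Section dotv.
Context {R : realType} {n : nat}.
Implicit Types u v w : 'rV[R]_n.

Lemma dotvDl u v w : dotv (u + v) w = dotv u w + dotv v w.
Proof.
by rewrite /dotv -big_split/=; apply: eq_bigr => i _; rewrite mxE mulrDl.
Qed.

Lemma dotvNl u w : dotv (- u) w = - dotv u w.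
Proof. by rewrite /dotv -sumrN; apply: eq_bigr => i _; rewrite mxE mulNr. Qed.

Lemma dotvZl a u w : dotv (a *: u) w = a * dotv u w.
Proof. by rewrite /dotv mulr_sumr; apply: eq_bigr => i _; rewrite mxE mulrA. Qed.

Lemma dotvC u w : dotv u w = dotv w u.
Proof. by apply: eq_bigr => i _; rewrite mulrC. Qed.

Lemma dotvBr u v w : dotv w (u - v) = dotv w u - dotv w v.
Proof. by rewrite dotvC dotvDl dotvNl !(dotvC w). Qed.

Lemma dotv0l u : dotv 0 u = 0.
Proof. by rewrite /dotv big1// => i _; rewrite mxE mul0r. Qed.

Lemma measurable_dotv u : measurable_fun setT (dotv u).
Proof.
apply: measurable_sum => i; apply: measurable_funM => //.
exact: coord_measurable.
Qed.

Lemma measurable_cos_dotv u :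
  measurable_fun setT (fun x : 'rV[R]_n => cos (2 * pi * dotv u x)).
Proof.
apply: measurableT_comp (measurable_funM _ (measurable_dotv u)) => //.
by apply: continuous_measurable_fun; exact: continuous_cos.
Qed.

Lemma measurable_sin_dotv u :
  measurable_fun setT (fun x : 'rV[R]_n => sin (2 * pi * dotv u x)).
Proof.
apply: measurableT_comp (measurable_funM _ (measurable_dotv u)) => //.
by apply: continuous_measurable_fun; exact: continuous_sin.
Qed.

End dotv.

(** * Averages of the squared Fourier transform, after Wiener *)

Section decay.
Context {R : realType} {k : nat}.
Variable nu : {finite_measure set 'rV[R]_k -> \bar R}.

Definition cos_transform (b : 'rV[R]_k) := \int[nu]_x cos (2 * pi * dotv b x).
Definition sin_transform (b : 'rV[R]_k) := \int[nu]_x sin (2 * pi * dotv b x).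

Lemma integrable_cos_dotv b :
  nu.-integrable setT (EFin \o (fun x => cos (2 * pi * dotv b x))).
Proof.
apply: (@bounded_integrable _ _ _ _ _ 1); first exact: measurable_cos_dotv.
by move=> x; rewrite ler_norml cos_geN1 cos_le1.
Qed.

Lemma integrable_sin_dotv b :
  nu.-integrable setT (EFin \o (fun x => sin (2 * pi * dotv b x))).
Proof.
apply: (@bounded_integrable _ _ _ _ _ 1); first exact: measurable_sin_dotv.
by move=> x; rewrite ler_norml sin_geN1 sin_le1.
Qed.

(* Averages are taken over the progression [t *: ray_dir i], [t < ray_len i]:
   for a fixed [z != 0] the phase step [dotv (ray_dir i) z] tends to 0, but the
   total phase is a nonconstant polynomial in [i.+1], hence unbounded. *)
Definition ray_dir (i : nat) : 'rV[R]_k :=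
  \row_j (i.+1%:R ^+ j.+1 / i.+1%:R ^+ k.+1).

Definition ray_len (i : nat) : nat := i.+1 ^ k.+1.

(** The total phase as a polynomial value. The factor ['X] keeps the polynomial nonconstant even
    when only the first coordinate of [z] is nonzero. *)
Lemma dotv_ray_dir i z :
  (ray_len i)%:R * dotv (ray_dir i) z = ('X * rVpoly z).[i.+1%:R].
Proof.
rewrite /dotv mulr_sumr hornerM hornerX (@horner_coef_wide _ k) ?size_poly//.
rewrite mulr_sumr; apply: eq_bigr => j _.
rewrite mxE coef_rVpoly_ord /ray_len natrX mulrA [RHS]mulrCA -exprS [RHS]mulrC.
by congr (_ * _); rewrite mulrC divfK// expf_neq0.
Qed.

Lemma cvg_dotv_ray_dir z : dotv (ray_dir i) z @[i --> \oo] --> (0 : R).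
Proof.
apply/norm_cvg0P.
have h : (\sum_j `|z 0 j|) * harmonic i @[i --> \oo] --> (0 : R).
  by rewrite -[X in _ --> X](mulr0 (\sum_j `|z 0 j|)); apply: cvgMr; exact: cvg_harmonic.
apply: (squeeze_cvgr _ (cvg_cst 0) h); near=> i.
rewrite normr_ge0/= /dotv mulr_suml (le_trans (ler_norm_sum _ _ _))//.
apply: ler_sum => j _; rewrite normrM mulrC ler_wpM2l// mxE.
rewrite ger0_norm ?divr_ge0 ?exprn_ge0//.
(* As j + 1 <= k, each coordinate of [ray_dir i] is at most 1 / (i + 1). *)
rewrite /harmonic/= ler_pdivrMr ?exprn_gt0// (exprS _ k) mulKf//.
by rewrite ler_weXn2l// ?ler1n// -ltnS ltn_ord.
Unshelve. all: by end_near. Qed.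

(** With s the phase step and M the length, s tends to 0, so |sin (pi s)| >= pi |s| / 2 >= |s|.
    Hence M |sin (pi s)| is at least the modulus of the total phase, which tends to infinity, and
    [cesaro_cos] bounds the average by the inverse. *)
Lemma cvg_ray_kernel z phi : z != 0 ->
  (ray_len i)%:R^-1 *
    \sum_(t < ray_len i) cos (2 * pi * (t%:R * dotv (ray_dir i) z) - phi)
  @[i --> \oo] --> (0 : R).
Proof.
move=> z0; apply/cvgrPdist_le => e e0.
have sz : (1 < size ('X * rVpoly z : {poly R})%R)%N.
  have p0 : rVpoly z != 0 by apply: contra_neq z0 => p0; rewrite -[z]rVpolyK p0 linear0.
  by rewrite mulrC size_mulX// ltnS size_poly_gt0.
have hpi : pi * dotv (ray_dir i) z @[i --> \oo] --> (0 : R).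
  by rewrite -[X in _ --> X](mulr0 pi); apply: cvgMr; exact: cvg_dotv_ray_dir.
have /= := hpi _ sin_lower; rewrite near_simpl => hsin.
near=> i.
rewrite sub0r normrN.
have M0 : (0 : R) < (ray_len i)%:R by rewrite ltr0n expn_gt0.
have le_e : e^-1 <= (ray_len i)%:R * `|sin (pi * dotv (ray_dir i) z)|.
  have h1 : `|pi * dotv (ray_dir i) z| / 2 <= `|sin (pi * dotv (ray_dir i) z)|.
    by near: i.
  apply: le_trans (ler_wpM2l (ltW M0) h1).
  have h2 : e^-1 <= `|('X * rVpoly z).[i.+1%:R]|.
    near: i; have [N _ hN] := @poly_norm_pinfty _ _ e^-1 sz.
    by exists N => // j /= Nj; apply: hN => /=; exact: leqW.
  rewrite -dotv_ray_dir normrM (gtr0_norm M0) in h2.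
  have p2 := pi_ge2 R.
  rewrite normrM (gtr0_norm (pi_gt0 R)) mulrA ler_pdivlMr//.
  have := mulr_ge0 (_ : 0 <= pi - 2 :> R)
    (mulr_ge0 (ltW M0) (normr_ge0 (dotv (ray_dir i) z))).
  by rewrite subr_ge0 => /(_ p2); lra.
have s0 : sin (pi * dotv (ray_dir i) z) != 0.
  by apply: contraTneq le_e => ->; rewrite normr0 mulr0 -ltNge invr_gt0.
apply: (le_trans (cesaro_cos _ _ _ s0)).
by rewrite -[leRHS]invrK lef_pV2// posrE ?invr_gt0// mulr_gt0// normr_gt0.
Unshelve. all: by end_near. Qed.

Lemma measurable_rV_set1 (x : 'rV[R]_k) : measurable [set x].
Proof.
rewrite -[[set x]]setCK; apply: measurableC; apply: open_measurable_rV.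
apply: closed_openC.
exact: accessible_closed_set1 (hausdorff_accessible (@norm_hausdorff _ _)) _.
Qed.

Lemma ae_neq (x : 'rV[R]_k) : nu [set x] = 0%E -> {ae nu, forall y, y != x}.
Proof.
move=> x0; exists [set x]; split => //; first exact: measurable_rV_set1.
by move=> y /= /negP; rewrite negbK => /eqP.
Qed.

(** The squared modulus of the transform at b is the double integral of cos (2 pi b.(y - x)), so its
    average integrates the kernel of [cvg_ray_kernel] at y - x. The kernel is bounded by 1 and tends
    to 0 unless y = x, which for fixed x is a null set. Dominated convergence is applied first in y,
    then in x. *)
Lemma decay_average (nu0 : atomless nu) (c : 'rV[R]_k) :
  (ray_len i)%:R^-1 * \sum_(t < ray_len i)
    (cos_transform (t%:R *: ray_dir i - c) ^+ 2 +
     sin_transform (t%:R *: ray_dir i - c) ^+ 2) @[i --> \oo] --> (0 : R).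
Proof.
pose b i t := t%:R *: ray_dir i - c : 'rV[R]_k.
(* [I i x] is the inner integral in y. The addition formula separates x from y, so linearity of the
   integral replaces Fubini's theorem. *)
pose I i x := (ray_len i)%:R^-1 * \sum_(t < ray_len i)
  (cos (2 * pi * dotv (b i t) x) * cos_transform (b i t) +
   sin (2 * pi * dotv (b i t) x) * sin_transform (b i t)).
have IE i x : I i x = \int[nu]_y ((ray_len i)%:R^-1 * \sum_(t < ray_len i)
    cos (2 * pi * (t%:R * dotv (ray_dir i) (y - x)) - 2 * pi * dotv c (y - x))).
  have E y (t : 'I_(ray_len i)) :
      cos (2 * pi * (t%:R * dotv (ray_dir i) (y - x)) - 2 * pi * dotv c (y - x)) =
      cos (2 * pi * dotv (b i t) x) * cos (2 * pi * dotv (b i t) y) +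
      sin (2 * pi * dotv (b i t) x) * sin (2 * pi * dotv (b i t) y).
    rewrite (_ : _ - _ = 2 * pi * dotv (b i t) y - 2 * pi * dotv (b i t) x).
      by rewrite cosB; ring.
    by rewrite /b !dotvBr !dotvDl !dotvNl !dotvZl; ring.
  under eq_Rintegral do under eq_bigr do rewrite E.
  have int t : nu.-integrable setT (EFin \o (fun y =>
      cos (2 * pi * dotv (b i t) x) * cos (2 * pi * dotv (b i t) y) +
      sin (2 * pi * dotv (b i t) x) * sin (2 * pi * dotv (b i t) y))).
    apply: integrable_RD; apply: integrable_RZl.
      exact: integrable_cos_dotv.
    exact: integrable_sin_dotv.
  rewrite RintegralZl//; last exact: (integrable_Rsum _ _ _ _ (fun t : 'I__ => int t)).
  rewrite Rintegral_sum; last by move=> t; exact: int.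
  congr (_ * _); apply: eq_bigr => t _.
  rewrite RintegralD//; [|apply: integrable_RZl..]; last 2 first.
  - exact: integrable_cos_dotv.
  - exact: integrable_sin_dotv.
  by rewrite !RintegralZl//; [exact: integrable_sin_dotv|exact: integrable_cos_dotv].
have cs_le1 (u : R) : `|cos u| <= 1 by rewrite ler_norml cos_geN1 cos_le1.
have ker_le1 i s phi : `|(ray_len i)%:R^-1 * \sum_(t < ray_len i)
    cos (2 * pi * (t%:R * s) - phi)| <= 1 :> R.
  rewrite normrM ger0_norm ?invr_ge0// mulrC ler_pdivrMr ?ltr0n ?expn_gt0// mul1r.
  rewrite (le_trans (ler_norm_sum _ _ _))//.
  rewrite (le_trans (ler_sum _ (fun t _ => cs_le1 _)))//.
  by rewrite sumr_const card_ord.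
have mker i (x : 'rV[R]_k) : measurable_fun setT (fun y : 'rV[R]_k =>
    (ray_len i)%:R^-1 * \sum_(t < ray_len i)
    cos (2 * pi * (t%:R * dotv (ray_dir i) (y - x)) - 2 * pi * dotv c (y - x))).
  apply: measurable_funM => //; apply: measurable_sum => t.
  have mcos : measurable_fun setT (@cos R).
    by apply: continuous_measurable_fun; exact: continuous_cos.
  apply: measurableT_comp mcos _; apply: measurable_funB.
    apply: measurable_funM => //; apply: measurable_funM => //.
    under eq_fun do rewrite dotvBr; apply: measurable_funB => //; exact: measurable_dotv.
  apply: measurable_funM => //.
  under eq_fun do rewrite dotvBr; apply: measurable_funB => //; exact: measurable_dotv.
have I0 x : I i x @[i --> \oo] --> (0 : R).
  under eq_fun do rewrite IE.
  apply: (@Rdominated_cvg0 _ _ _ _ _ 1) => //.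
  apply: filterS (ae_neq x (nu0 x)) => y yx; apply: cvg_ray_kernel.
  by rewrite subr_eq0.
have Ile i x : `|I i x| <= fine (nu setT).
  rewrite IE (le_trans (le_normr_Rintegral _ _))//.
    exact: (@bounded_integrable _ _ _ _ _ 1).
  rewrite -[leRHS]mul1r -Rintegral_cst//; apply: le_Rintegral => //.
    by apply: (@bounded_integrable _ _ _ _ _ 1) => [|x'];
      [exact: measurableT_comp|rewrite normr_id].
  exact: finite_measure_integrable_cst.
have mI i : measurable_fun setT (I i).
  apply: measurable_funM => //; apply: measurable_sum => t.
  apply: measurable_funD; apply: measurable_funM => //.
    exact: measurable_cos_dotv.
  exact: measurable_sin_dotv.
have := Rdominated_cvg0 nu I _ mI Ile (aeW _ I0).
apply: cvg_trans; apply: near_eq_cvg; near=> i; apply/esym.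
have int t : nu.-integrable setT (EFin \o (fun x =>
      cos (2 * pi * dotv (b i t) x) * cos_transform (b i t) +
      sin (2 * pi * dotv (b i t) x) * sin_transform (b i t))).
  under eq_fun do rewrite mulrC [X in _ + X]mulrC.
  apply: integrable_RD; apply: integrable_RZl.
    exact: integrable_cos_dotv.
  exact: integrable_sin_dotv.
rewrite RintegralZl//; last exact: (integrable_Rsum _ _ _ _ (fun t : 'I__ => int t)).
rewrite Rintegral_sum; last by move=> t; exact: int.
congr (_ * _); apply: eq_bigr => t _.
have intc := integrable_cos_dotv (b i t).
have ints := integrable_sin_dotv (b i t).
rewrite RintegralD//; last 2 first.
- by under eq_fun do rewrite mulrC; exact: integrable_RZl.
- by under eq_fun do rewrite mulrC; exact: integrable_RZl.
by rewrite !RintegralZr// !expr2.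
Unshelve. all: by end_near. Qed.

(** One b must serve all c in [s]: the averages are added over [s], the sum still tends to 0, and an
    average below [e ^+ 2] has a term below [e ^+ 2]. *)
Lemma exists_decay (nu0 : atomless nu) (s : seq 'rV[R]_k) (e : R) : 0 < e ->
  exists b, forall c, c \in s ->
    `|cos_transform (b - c)| <= e /\ `|sin_transform (b - c)| <= e.
Proof.
move=> e0.
pose F b := \sum_(c <- s) (cos_transform (b - c) ^+ 2 + sin_transform (b - c) ^+ 2).
have F0 : (ray_len i)%:R^-1 * \sum_(t < ray_len i) F (t%:R *: ray_dir i)
    @[i --> \oo] --> (0 : R).
  rewrite /F; elim: s {F} => [|c s IH].
    rewrite (_ : (fun _ => _) = cst 0); first exact: cvg_cst.
    by apply/funext => i; rewrite big1 ?mulr0// => t _; rewrite big_nil.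
  have := @cvgD _ _ _ _ eventually_filter _ _ _ _ (decay_average nu0 c) IH; rewrite addr0.
  apply: cvg_trans; apply: near_eq_cvg; apply: nearW => i /=.
  rewrite [RHS](_ : _ = (ray_len i)%:R^-1 * (\sum_(t < ray_len i)
      (cos_transform (t%:R *: ray_dir i - c) ^+ 2 +
       sin_transform (t%:R *: ray_dir i - c) ^+ 2) +
    \sum_(t < ray_len i) \sum_(c0 <- s)
      (cos_transform (t%:R *: ray_dir i - c0) ^+ 2 +
       sin_transform (t%:R *: ray_dir i - c0) ^+ 2))); first by rewrite mulrDr.
  by rewrite -big_split/=; congr (_ * _); apply: eq_bigr => t _; rewrite big_cons.
have /cvgrPdist_lt /(_ _ (exprn_gt0 2 e0)) [N _ /(_ N (leqnn N))] := F0.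
rewrite /= sub0r normrN => hN.
have [b Fb] : exists b, F b < e ^+ 2.
  apply: contrapT => /forallNP h.
  have le : \sum_(t < ray_len N) e ^+ 2 <= \sum_(t < ray_len N) F (t%:R *: ray_dir N).
    by apply: ler_sum => t _; rewrite leNgt; apply/negP; exact: h.
  rewrite sumr_const card_ord -mulr_natl in le.
  have M0 : (0 : R) < (ray_len N)%:R by rewrite ltr0n expn_gt0.
  move: hN; rewrite ltNge => /negP; apply; apply: le_trans (ler_norm _).
  by rewrite mulrC ler_pdivlMr// mulrC.
exists b => c cs.
have : cos_transform (b - c) ^+ 2 + sin_transform (b - c) ^+ 2 <= F b.
  rewrite /F (big_rem c)//= lerDl; apply: sumr_ge0 => c' _.
  by rewrite addr_ge0// sqr_ge0.
move=> /le_lt_trans/(_ Fb) lt.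
have := sqr_ge0 (cos_transform (b - c)); have := sqr_ge0 (sin_transform (b - c)).
move=> s0 c0; split; rewrite -ler_sqr ?nnegrE ?(ltW e0)// real_normK ?num_real//; lra.
Qed.

End decay.

(** * Almost orthogonal exponentials *)

Section sparse_sequence.
Context {R : realType} {k : nat}.
Variable nu : {finite_measure set 'rV[R]_k -> \bar R}.

(** Dependent choice in which each term may depend on the list of all earlier ones. *)
Lemma sequence_of_history (T : Type) (P : seq T -> T -> Prop) :
  (forall s, exists x, P s x) -> exists f : nat -> T, forall n, P (mkseq f n) (f n).
Proof.
move=> /choice[h hP].
pose l n := iter n (fun s => rcons s (h s)) [::].
exists (h \o l) => n; suff -> : mkseq (h \o l) n = l n by exact: hP.
by elim: n => // n IH; rewrite mkseqS IH.
Qed.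

Lemma cos_transform0 : cos_transform nu 0 = fine (nu setT).
Proof.
rewrite /cos_transform -[RHS]mul1r -Rintegral_cst//.
by apply: eq_Rintegral => x _; rewrite dotv0l mulr0 cos0.
Qed.

Lemma sin_transform0 : sin_transform nu 0 = 0.
Proof.
rewrite /sin_transform -[RHS](mul0r (fine (nu setT))) -Rintegral_cst//.
by apply: eq_Rintegral => x _; rewrite dotv0l mulr0 sin0.
Qed.

Lemma cos_transformN b : cos_transform nu (- b) = cos_transform nu b.
Proof. by apply: eq_Rintegral => x _; rewrite dotvNl mulrN cosN. Qed.

Lemma sin_transformN b : sin_transform nu (- b) = - sin_transform nu b.
Proof.
rewrite -mulN1r -RintegralZl//; last exact: integrable_sin_dotv.
by apply: eq_Rintegral => x _; rewrite dotvNl mulrN sinN mulN1r.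
Qed.

Lemma exists_notin (s : seq 'rV[R]_k) : (0 < k)%N -> exists b, b \notin s.
Proof.
move=> k0; pose i := Ordinal k0.
(* One coordinate larger than that of every vector in [s]; this is where k > 0 enters. *)
exists (const_mx (1 + \sum_(c <- s) `|c 0 i|)); apply/negP => bs.
have : 1 + \sum_(c <- s) `|c 0 i| <= \sum_(c <- s) `|c 0 i|.
  rewrite [leRHS](big_rem _ bs)/= mxE; apply: le_trans (ler_norm _) _.
  by rewrite lerDl sumr_ge0.
by rewrite gerDr ler10.
Qed.

Lemma exists_decay_notin (s : seq 'rV[R]_k) (e : R) : (0 < k)%N ->
  atomless nu -> 0 < e ->
  exists b, b \notin s /\ forall c, c \in s ->
    `|cos_transform nu (b - c)| <= e /\ `|sin_transform nu (b - c)| <= e.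
Proof.
move=> k0 nu0 e0.
(* For the zero measure all transforms vanish, and any b outside [s] will do. *)
have [nuT|nuT] := eqVneq (nu setT) 0%E.
  have [b bs] := exists_notin s k0; exists b; split => // c _.
  have null (f : 'rV[R]_k -> R) : measurable_fun setT f -> \int[nu]_x f x = 0.
    by move=> mf; rewrite /Rintegral null_set_integral//; exact/measurable_EFinP.
  rewrite /cos_transform /sin_transform !null ?normr0 ?ltW//.
    exact: measurable_sin_dotv.
  exact: measurable_cos_dotv.
have nu_gt0 : 0 < fine (nu setT).
  by rewrite fine_gt0// lt0e nuT measure_ge0 ltey_eq fin_num_measure.
(* The transform at 0 is the total mass, so a tolerance of half the mass rules out b = c for c in
   [s]. *)
have d0 : 0 < Num.min e (fine (nu setT) / 2) by rewrite lt_min e0 divr_gt0.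
have [b hb] := exists_decay nu nu0 s _ d0; exists b; split.
  apply/negP => /hb[]; rewrite subrr cos_transform0 le_min => /andP[_].
  rewrite gtr0_norm//; lra.
by move=> c /hb; rewrite !le_min => -[/andP[? _] /andP[? _]].
Qed.

(** The two transforms are the real and imaginary parts of the inner product in L^2(nu) of the
    exponentials with frequencies [b n] and [b m]. The product form of the bound makes the
    off-diagonal Gram entries summable. *)
Definition almost_orthogonal (b : nat -> 'rV[R]_k) := forall n m, n != m ->
  `|cos_transform nu (b n - b m)| <= 2^-1 ^+ n * 2^-1 ^+ m /\
  `|sin_transform nu (b n - b m)| <= 2^-1 ^+ n * 2^-1 ^+ m.

Let half_gt0 : 0 < 2^-1 :> R. Proof. by rewrite invr_gt0. Qed.

Lemma exists_almost_orthogonal : (0 < k)%N -> atomless nu ->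
  exists b : nat -> 'rV[R]_k, injective b /\ almost_orthogonal b.
Proof.
move=> k0 nu0.
(* The n-th term has tolerance 2^-(2n), which is at most 2^-n 2^-m for every earlier m; later m
   follow from the parity of the transforms. *)
have [b hb] := sequence_of_history _ _ (fun s : seq 'rV[R]_k =>
  exists_decay_notin s _ k0 nu0 (exprn_gt0 (size s + size s) half_gt0)).
have lt_bound n m : (m < n)%N -> b n != b m /\
    `|cos_transform nu (b n - b m)| <= 2^-1 ^+ n * 2^-1 ^+ m /\
    `|sin_transform nu (b n - b m)| <= 2^-1 ^+ n * 2^-1 ^+ m.
  move=> mn; have [bn hn] := hb n.
  have bm : b m \in mkseq b n by apply: map_f; rewrite mem_iota.
  split; first by apply: contraNneq bn => ->.
  have [] := hn _ bm; rewrite size_mkseq => h1 h2.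
  have le : (2^-1 : R) ^+ (n + n) <= 2^-1 ^+ n * 2^-1 ^+ m.
    by rewrite -exprD ler_wiXn2l// ?invr_le1 ?unitfE// ?ler1n// leq_add2l ltnW.
  by split; exact: le_trans le.
exists b; split.
  move=> n m bnm; apply/eqP; case: ltngtP => // /lt_bound[].
    by rewrite bnm eqxx.
  by rewrite bnm eqxx.
move=> n m; rewrite neq_ltn => /orP[] /lt_bound[_ //].
by rewrite -opprB cos_transformN sin_transformN normrN mulrC.
Qed.

End sparse_sequence.

(** * The Gram matrix of an almost orthogonal sequence *)

Section bessel.
Context {R : realType} {k : nat}.
Variable nu : {finite_measure set 'rV[R]_k -> \bar R}.

Lemma sum_half_le2 N : \sum_(n < N) (2^-1 : R) ^+ n <= 2.
Proof.
suff -> : \sum_(n < N) (2^-1 : R) ^+ n = 2 - 2 * 2^-1 ^+ N.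
  by rewrite gerBl mulr_ge0// exprn_ge0// invr_ge0.
elim: N => [|N IH]; first by rewrite big_ord0 mulr1 subrr.
by rewrite big_ord_recr/= IH exprS; field.
Qed.

(* The left-hand side is the squared norm of [\sum_n (X n - i Y n) e_n] in
   L^2(nu), where [e_n] is the exponential of frequency [b n]. *)
Lemma gram_bound (b : nat -> 'rV[R]_k) (X Y : nat -> R) N : almost_orthogonal nu b ->
  \sum_(n < N) \sum_(m < N)
    ((X n * X m + Y n * Y m) * cos_transform nu (b n - b m) +
     (Y n * X m - X n * Y m) * sin_transform nu (b n - b m))
  <= (fine (nu setT) + 4) * \sum_(n < N) (X n ^+ 2 + Y n ^+ 2).
Proof.
move=> ob; pose a n := X n ^+ 2 + Y n ^+ 2.
have a0 n : 0 <= a n by rewrite addr_ge0// sqr_ge0.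
pose h n : R := 2^-1 ^+ n.
have h0 n : 0 <= h n by rewrite exprn_ge0// invr_ge0.
have h1 n : h n <= 1 by rewrite exprn_ile1// ?invr_ge0// invf_le1// ler1n.
have nuT : 0 <= fine (nu setT) by rewrite fine_ge0.
(* The diagonal contributes the total mass times [a n]. Off the diagonal each of the two
   coefficients is at most (a n + a m) / 2, and each transform at most h n h m. *)
have term n m : (X n * X m + Y n * Y m) * cos_transform nu (b n - b m) +
     (Y n * X m - X n * Y m) * sin_transform nu (b n - b m) <=
   (n == m)%:R * (fine (nu setT) * a n) + (a n * h n * h m + a m * h m * h n).
  have r0 : 0 <= a n * h n * h m + a m * h m * h n by rewrite addr_ge0// !mulr_ge0.
  have [nm|nm] := eqVneq n m.
    rewrite nm in r0 *; rewrite subrr cos_transform0 sin_transform0 mulr0 addr0.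
    rewrite mul1r -!expr2.
    by rewrite [leLHS]mulrC lerDl.
  rewrite mul0r add0r; have [+ +] := ob n m nm; rewrite -/(h n) -/(h m).
  set C := cos_transform _ _; set S := sin_transform _ _; set e := h n * h m.
  have -> : a n * h n * h m + a m * h m * h n = (a n + a m) * e by rewrite /e; ring.
  move=> hC hS.
  have e0 : 0 <= e by exact: le_trans hC.
  have bnd (u v : R) : `|u| <= (a n + a m) / 2 -> `|v| <= e -> u * v <= (a n + a m) / 2 * e.
    by move=> hu hv; rewrite (le_trans (ler_norm _))// normrM ler_pM.
  have -> : (a n + a m) * e = (a n + a m) / 2 * e + (a n + a m) / 2 * e by field.
  apply: lerD; apply: bnd => //; rewrite ler_norml /a; apply/andP; split.
  - have := sqr_ge0 (X n + X m); have := sqr_ge0 (Y n + Y m); rewrite !sqrrD; lra.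
  - have := sqr_ge0 (X n - X m); have := sqr_ge0 (Y n - Y m); rewrite !sqrrB; lra.
  - have := sqr_ge0 (Y n + X m); have := sqr_ge0 (X n - Y m); rewrite !sqrrB !sqrrD; lra.
  - have := sqr_ge0 (Y n - X m); have := sqr_ge0 (X n + Y m); rewrite !sqrrB !sqrrD; lra.
apply: (@le_trans _ _ (\sum_(n < N) \sum_(m < N)
   ((n == m)%:R * (fine (nu setT) * a n) + (a n * h n * h m + a m * h m * h n)))).
  by apply: ler_sum => n _; apply: ler_sum => m _; exact: term.
(* Uses h n <= 1 and a geometric sum of at most 2. This bound and its mirror image under exchange of
   n and m make up the constant 4. *)
have half : \sum_(n < N) \sum_(m < N) a n * h n * h m <= 2 * \sum_(n < N) a n.
  rewrite mulr_sumr; apply: ler_sum => n _; rewrite -mulr_sumr mulrC.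
  apply: ler_pM; rewrite ?sumr_ge0 ?mulr_ge0 ?sum_half_le2//.
  by rewrite ler_piMr.
rewrite -[X in _ <= _ * X]/(\sum_(n < N) a n).
set A := \sum_(n < N) a n in half *.
under eq_bigr do rewrite big_split big_split/=.
rewrite !big_split/= [X in _ + (_ + X)]exchange_big/=.
rewrite mulrDl lerD//.
  rewrite /A mulr_sumr ler_sum// => n _; rewrite (bigD1 n)//= eqxx mul1r big1 ?addr0//.
  by move=> m; rewrite eq_sym => /negPf; rewrite -val_eqE/= => ->; rewrite mul0r.
rewrite (_ : 4 = 2 + 2)// ?mulrDl ?lerD//; lra.
Qed.

End bessel.

(** * Square integrable functions and Bessel's inequality *)

Section square_integrable.
Context {R : realType} {k : nat}.
Variable nu : {finite_measure set 'rV[R]_k -> \bar R}.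
Implicit Types g : 'rV[R]_k -> R[i].

Lemma normc_sqr (z : R[i]) : normc z ^+ 2 = complex.Re z ^+ 2 + complex.Im z ^+ 2.
Proof. by case: z => a b /=; rewrite sqr_sqrtr// addr_ge0// sqr_ge0. Qed.

Lemma Re_mul_cis (z : R[i]) (t : R) :
  complex.Re (z * cis t) = complex.Re z * cos t - complex.Im z * sin t.
Proof. by case: z. Qed.

Lemma Im_mul_cis (z : R[i]) (t : R) :
  complex.Im (z * cis t) = complex.Re z * sin t + complex.Im z * cos t.
Proof. by case: z. Qed.

Lemma square_integrable_normc_sqr g : square_integrable nu g ->
  nu.-integrable setT (EFin \o (fun x => normc (g x) ^+ 2)).
Proof.
move=> [mRe mIm fin]; apply/integrableP; split.
  apply/measurable_EFinP; under eq_fun do rewrite normc_sqr.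
  by apply: measurable_funD; apply: measurable_funX.
under eq_integral do rewrite /= ger0_norm ?sqr_ge0//.
exact: fin.
Qed.

Lemma sqL2normE g : square_integrable nu g ->
  sqL2norm nu g = (\int[nu]_x (normc (g x) ^+ 2))%:E.
Proof.
move=> gint; rewrite /sqL2norm /Rintegral fineK//.
by apply: integrable_fin_num => //; exact: square_integrable_normc_sqr.
Qed.

Lemma square_integrable_dominated g (f : 'rV[R]_k -> R) :
  square_integrable nu g -> measurable_fun setT f ->
  (forall x, `|f x| <= 1 + normc (g x) ^+ 2) ->
  nu.-integrable setT (EFin \o f).
Proof.
move=> gint mf fle.
apply: (@le_integrable _ _ _ nu setT measurableT _
  (EFin \o (fun x => 1 + normc (g x) ^+ 2))).
- exact/measurable_EFinP.
- by move=> x _; rewrite /= lee_fin (le_trans (fle x))// ler_norm.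
- apply: integrable_RD; first exact: finite_measure_integrable_cst.
  exact: square_integrable_normc_sqr.
Qed.

Lemma integrable_Re_mul_cis g b : square_integrable nu g -> nu.-integrable setT
  (EFin \o (fun x => complex.Re (g x * cis (2 * pi * dotv b x)))).
Proof.
move=> gint; have [mRe mIm _] := gint.
apply: (square_integrable_dominated _ _ gint).
  under eq_fun do rewrite Re_mul_cis.
  apply: measurable_funB; apply: measurable_funM => //.
    exact: measurable_cos_dotv.
  exact: measurable_sin_dotv.
move=> x; rewrite Re_mul_cis normc_sqr; set t := 2 * pi * _.
have := cos2Dsin2 t; set p := complex.Re _; set q := complex.Im _.
move=> cs; rewrite ler_norml; apply/andP; split.
- have := sqr_ge0 (p + cos t); have := sqr_ge0 (q - sin t); rewrite !sqrrB !sqrrD.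
  have := sqr_ge0 p; have := sqr_ge0 q; nra.
- have := sqr_ge0 (p - cos t); have := sqr_ge0 (q + sin t); rewrite !sqrrB !sqrrD.
  have := sqr_ge0 p; have := sqr_ge0 q; nra.
Qed.

Lemma integrable_Im_mul_cis g b : square_integrable nu g -> nu.-integrable setT
  (EFin \o (fun x => complex.Im (g x * cis (2 * pi * dotv b x)))).
Proof.
move=> gint; have [mRe mIm _] := gint.
apply: (square_integrable_dominated _ _ gint).
  under eq_fun do rewrite Im_mul_cis.
  apply: measurable_funD; apply: measurable_funM => //.
    exact: measurable_sin_dotv.
  exact: measurable_cos_dotv.
move=> x; rewrite Im_mul_cis normc_sqr; set t := 2 * pi * _.
have := cos2Dsin2 t; set p := complex.Re _; set q := complex.Im _.
move=> cs; rewrite ler_norml; apply/andP; split.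
- have := sqr_ge0 (p + sin t); have := sqr_ge0 (q + cos t); rewrite !sqrrD.
  have := sqr_ge0 p; have := sqr_ge0 q; nra.
- have := sqr_ge0 (p - sin t); have := sqr_ge0 (q - cos t); rewrite !sqrrB.
  have := sqr_ge0 p; have := sqr_ge0 q; nra.
Qed.

(** This is |K z - conj(S)|^2 >= 0 expanded, for z = p + iq and S = a + ib. *)
Lemma am_gm (K p q a b : R) :
  2 * K * (p * a - q * b) <= K ^+ 2 * (p ^+ 2 + q ^+ 2) + (a ^+ 2 + b ^+ 2).
Proof.
have := sqr_ge0 (K * p - a); have := sqr_ge0 (K * q + b).
by rewrite sqrrB sqrrD !exprMn; lra.
Qed.

(* Integrate [2 K Re (g S) <= K^2 |g|^2 + |S|^2] with
   [S = \sum_n conj(c_n) e_n], where c_n are the coefficients of g. *)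
Lemma bessel g (b : nat -> 'rV[R]_k) N : square_integrable nu g ->
  almost_orthogonal nu b ->
  \sum_(n < N) normc (fourier_coef nu g (b n)) ^+ 2 <=
  (fine (nu setT) + 4) * \int[nu]_x (normc (g x) ^+ 2).
Proof.
move=> gint ob; set K := fine _ + 4.
have K0 : 0 < K by rewrite ltr_wpDl// fine_ge0.
pose X n := complex.Re (fourier_coef nu g (b n)).
pose Y n := complex.Im (fourier_coef nu g (b n)).
pose c n x := cos (2 * pi * dotv (b n) x).
pose s n x := sin (2 * pi * dotv (b n) x).
under eq_bigr do rewrite normc_sqr -/(X _) -/(Y _).
set XX := \sum_(n < N) _.
(* [F] is Re (g S), with integral [XX], and [G] is |S|^2 in expanded form, whose integral
   [gram_bound] controls. *)
pose F x := \sum_(n < N) (X n * complex.Re (g x * cis (2 * pi * dotv (b n) x)) +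
                          Y n * complex.Im (g x * cis (2 * pi * dotv (b n) x))).
pose G x := \sum_(n < N) \sum_(m < N)
  ((X n * X m + Y n * Y m) * cos (2 * pi * dotv (b n - b m) x) +
   (Y n * X m - X n * Y m) * sin (2 * pi * dotv (b n - b m) x)).
have intFn (n : 'I_N) : nu.-integrable setT (EFin \o (fun x =>
    X n * complex.Re (g x * cis (2 * pi * dotv (b n) x)) +
    Y n * complex.Im (g x * cis (2 * pi * dotv (b n) x)))).
  apply: integrable_RD; apply: integrable_RZl.
    exact: integrable_Re_mul_cis.
  exact: integrable_Im_mul_cis.
have intF : nu.-integrable setT (EFin \o F) by exact: integrable_Rsum.
have FE : \int[nu]_x F x = XX.
  rewrite Rintegral_sum//; apply: eq_bigr => n _.
  rewrite RintegralD//; [|apply: integrable_RZl..]; last 2 first.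
  - exact: integrable_Re_mul_cis.
  - exact: integrable_Im_mul_cis.
  rewrite !RintegralZl//; last 2 first.
  - exact: integrable_Im_mul_cis.
  - exact: integrable_Re_mul_cis.
have intGnm (n m : 'I_N) : nu.-integrable setT (EFin \o (fun x =>
   (X n * X m + Y n * Y m) * cos (2 * pi * dotv (b n - b m) x) +
   (Y n * X m - X n * Y m) * sin (2 * pi * dotv (b n - b m) x))).
  apply: integrable_RD; apply: integrable_RZl.
    exact: integrable_cos_dotv.
  exact: integrable_sin_dotv.
have intG : nu.-integrable setT (EFin \o G).
  by apply: integrable_Rsum => n; exact: integrable_Rsum.
have GE : \int[nu]_x G x <= K * XX.
  apply: le_trans (gram_bound nu b X Y N ob).
  rewrite Rintegral_sum => [|n]; last exact: integrable_Rsum.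
  apply: ler_sum => n _; rewrite Rintegral_sum//; apply: ler_sum => m _.
  rewrite RintegralD//; [|apply: integrable_RZl..]; last 2 first.
  - exact: integrable_cos_dotv.
  - exact: integrable_sin_dotv.
  by rewrite !RintegralZl//; [exact: integrable_sin_dotv|exact: integrable_cos_dotv].
have FG x : 2 * K * F x <= K ^+ 2 * normc (g x) ^+ 2 + G x.
  (* [SR] and [SI] are the real and imaginary parts of S. *)
  pose SR := \sum_(n < N) (X n * c n x + Y n * s n x).
  pose SI := \sum_(n < N) (X n * s n x - Y n * c n x).
  have -> : F x = complex.Re (g x) * SR - complex.Im (g x) * SI.
    rewrite /SR /SI !mulr_sumr -sumrB; apply: eq_bigr => n _.
    by rewrite Re_mul_cis Im_mul_cis /c /s; ring.
  have -> : G x = SR ^+ 2 + SI ^+ 2.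
    rewrite !expr2 /SR /SI !mulr_suml -big_split/=; apply: eq_bigr => n _.
    rewrite !mulr_sumr -big_split/=; apply: eq_bigr => m _.
    by rewrite dotvDl dotvNl mulrDr mulrN cosB sinB
      -/(c _ _) -/(c m _) -/(s n _) -/(s m _); ring.
  rewrite normc_sqr; exact: am_gm.
have intg := square_integrable_normc_sqr g gint.
have : 2 * K * XX <= K ^+ 2 * (\int[nu]_x (normc (g x) ^+ 2)) + K * XX.
  rewrite -FE -RintegralZl//.
  apply: (@le_trans _ _ (\int[nu]_x (K ^+ 2 * normc (g x) ^+ 2 + G x))).
    apply: le_Rintegral => //; first exact: integrable_RZl.
    by apply: integrable_RD => //; exact: integrable_RZl.
  rewrite RintegralD//; last exact: integrable_RZl.
  by rewrite RintegralZl// lerD2l FE.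
(* Half of the left side of [h] absorbs [K * XX]; dividing by [K] leaves the claim. *)
move=> h; rewrite -(ler_pM2l K0); lra.
Qed.

Lemma esum_bessel g (b : nat -> 'rV[R]_k) : square_integrable nu g ->
  almost_orthogonal nu b ->
  (\esum_(n in [set: nat]) (normc (fourier_coef nu g (b n)) ^+ 2)%:E <=
    (fine (nu setT) + 4)%:E * sqL2norm nu g)%E.
Proof.
move=> gint ob; rewrite -nneseries_esumT => [|n]; last by rewrite lee_fin sqr_ge0.
apply: lime_le => [|]; first by apply: is_cvg_nneseries => n _ _; rewrite lee_fin sqr_ge0.
apply: nearW => n; rewrite sumEFin big_mkord (sqL2normE g gint) -EFinM lee_fin.
exact: bessel.
Qed.

End square_integrable.

(** * Frames for the pair of measures *)

Section esum_lemmas.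
Context {R : realType} {T : choiceType}.
Implicit Types (A B : set T) (a : T -> \bar R).

Lemma subset_esum A B a : A `<=` B -> (forall i, B i -> 0 <= a i)%E ->
  (\esum_(i in A) a i <= \esum_(i in B) a i)%E.
Proof.
move=> AB a0; rewrite (esumID A B)// (setIidr AB) leeDl// esum_ge0// => i [Bi _].
exact: a0.
Qed.

Lemma esum_setU_le A B a : (forall i, 0 <= a i)%E ->
  (\esum_(i in A `|` B) a i <= \esum_(i in A) a i + \esum_(i in B) a i)%E.
Proof.
move=> a0; rewrite (esumID A (A `|` B))// setUK leeD2l//.
by apply: subset_esum => // i [[]].
Qed.

Lemma esum_cst_ord N (x : \bar R) : (0 <= x)%E -> (\esum_(j in `I_N) x = \sum_(j < N) x)%E.
Proof.
move=> x0; rewrite esum_fset//.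
by rewrite -fsbig_ord.
Qed.

End esum_lemmas.

(** * Frequency pairs giving both frame inequalities *)

Section product_frame.
Context {R : realType}.

(** The doubled squares are written as sums, so that they pass to extended real sums by
    additivity. *)
Lemma normc_sqrD (x y : R[i]) :
  normc (x + y) ^+ 2 <= (normc x ^+ 2 + normc x ^+ 2) + (normc y ^+ 2 + normc y ^+ 2).
Proof.
case: x y => a b [c d]; rewrite !normc_sqr/=.
have := sqr_ge0 (a - c); have := sqr_ge0 (b - d); rewrite !sqrrB !sqrrD; lra.
Qed.

Lemma normc_sqr_leD (x y : R[i]) :
  normc x ^+ 2 <= (normc (x + y) ^+ 2 + normc (x + y) ^+ 2) + (normc y ^+ 2 + normc y ^+ 2).
Proof.
have := normc_sqrD (x + y) (- y); rewrite addrK.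
by rewrite (_ : normc (- y) ^+ 2 = normc y ^+ 2)// !normc_sqr;
  case: y => c d /=; rewrite !sqrrN.
Qed.

(* Each frequency [u] of the frame of [mu] is repeated [N] times, paired with
   distinct terms of the almost orthogonal sequence [b]. *)
Lemma repeated_frame m k (mu : {finite_measure set 'rV[R]_m -> \bar R})
    (nu : {finite_measure set 'rV[R]_k -> \bar R}) (U : set 'rV[R]_m) (A B : R)
    (b : nat -> 'rV[R]_k) (N : nat) :
  fourier_frame mu U A B -> injective b -> almost_orthogonal nu b ->
  exists L : set ('rV[R]_m * 'rV[R]_k), countable L /\
    forall f g, square_integrable mu f -> square_integrable nu g ->
    exists s : R, [/\
      \esum_(z in L) (normc (fourier_coef mu f z.1 + fourier_coef nu g z.2) ^+ 2)%:E
        = s%:E,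
      N%:R * A * \int[mu]_x (normc (f x) ^+ 2)
        <= 2 * s + 2 * (fine (nu setT) + 4) * \int[nu]_x (normc (g x) ^+ 2) &
      s <= 2 * N%:R * B * \int[mu]_x (normc (f x) ^+ 2)
           + 2 * (fine (nu setT) + 4) * \int[nu]_x (normc (g x) ^+ 2)].
Proof.
move=> [cU A0 AB frame] binj bo.
have /countable_injP[code codeinj] := cU.
(* An injective numbering of the pairs (u, j), so that no term of [b] is used twice. *)
pose idx (p : 'rV[R]_m * nat) : nat := pickle (code p.1, p.2).
pose e p := (p.1, b (idx p)).
pose P := U `*`` (fun=> `I_N).
have idxinj : set_inj P idx.
  move=> [u i] [v j] /[!inE] -[/= Uu _] [/= Uv _] /(pcan_inj pickleK)[cuv ->].
  by rewrite (codeinj u v) ?inE.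
have einj : set_inj P e by move=> p q Pp Pq [_ /binj]; exact: idxinj.
exists (e @` P); split.
  apply: (@sub_countable _ _ _ [set: nat]) => //.
  apply: card_le_trans (card_image_le _ _) _.
  by apply/pcard_injP; exists idx.
move=> f g fint gint.
set S := (\esum_(z in _) _)%E.
pose F u := (normc (fourier_coef mu f u) ^+ 2)%:E.
pose G v := (normc (fourier_coef nu g v) ^+ 2)%:E.
have F0 u : (0 <= F u)%E by rewrite lee_fin sqr_ge0.
have G0 v : (0 <= G v)%E by rewrite lee_fin sqr_ge0.
(* [SF] and [SG] are the separate contributions of [f] and [g]: the first is [N] times the frame sum
   of [mu], the second at most the Bessel sum along [b]. *)
pose SF := (\esum_(z in e @` P) F z.1)%E.
pose SG := (\esum_(z in e @` P) G z.2)%E.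
have SFE : SF = (\sum_(j < N) \esum_(u in U) F u)%E.
  rewrite /SF (esum_image P e)//= -(@esum_esum _ _ _ U (fun=> `I_N) (fun u _ => F u))//.
  under eq_esum do rewrite esum_cst_ord//.
  by rewrite esum_sum.
have SGle : (SG <= \esum_(n in [set: nat]) G (b n))%E.
  rewrite /SG (esum_image P e)//= -(esum_image P idx (fun n => G (b n)))//.
  exact: subset_esum.
have S_le : (S <= (SF + SF) + (SG + SG))%E.
  rewrite /SF /SG -!esumD//; try by move=> *; rewrite ?adde_ge0.
  by apply: le_esum => z _; rewrite -!EFinD lee_fin; exact: normc_sqrD.
have SF_le : (SF <= (S + S) + (SG + SG))%E.
  rewrite /S /SG -!esumD//; try by move=> *; rewrite ?adde_ge0// lee_fin sqr_ge0.
  by apply: le_esum => z _; rewrite -!EFinD lee_fin; exact: normc_sqr_leD.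
have /andP[] := frame f fint; rewrite (sqL2normE mu f fint).
rewrite -/(\esum_(u in U) F u)%E -!EFinM.
set nf := \int[mu]_x _ => frl fru.
have := esum_bessel nu g b gint bo; rewrite (sqL2normE nu g gint).
rewrite -EFinM; set K := fine _ + 4; set ng := \int[nu]_x _.
move=> /(le_trans SGle) SGub.
have SG_ge0 : (0 <= SG)%E by exact: esum_ge0.
have S_ge0 : (0 <= S)%E by apply: esum_ge0 => z _; rewrite lee_fin sqr_ge0.
(* All sums are shown to be finite, which brings the estimates down to real numbers. *)
have fr_ge0 : (0 <= \esum_(u in U) F u)%E by exact: esum_ge0.
have fr_fin : (\esum_(u in U) F u)%E \is a fin_num.
  by rewrite ge0_fin_numE// (le_lt_trans fru) ?ltry.
have SG_fin : SG \is a fin_num by rewrite ge0_fin_numE// (le_lt_trans SGub) ?ltry.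
move: frl fru SFE; rewrite -(fineK fr_fin); set fr := fine _ => frl fru SFE.
move: SGub S_le SF_le; rewrite -(fineK SG_fin); set sg := fine _.
rewrite {}SFE sumEFin sumr_const card_ord -mulr_natl -!EFinD => SGub S_le.
have S_fin : S \is a fin_num by rewrite ge0_fin_numE// (le_lt_trans S_le) ?ltry.
move: S_le; rewrite -(fineK S_fin); set s := fine _.
rewrite -!EFinD !lee_fin => S_le SF_le; rewrite !lee_fin in frl fru SGub.
exists s; split => //.
  by have := ler_wpM2l (ler0n R N) frl; lra.
by have := ler_wpM2l (ler0n R N) fru; lra.
Qed.

Lemma countable_image (T T' : Type) (D : set T) (f : T -> T') :
  countable D -> countable (f @` D).
Proof. by move=> cD; apply: sub_countable cD; exact: card_image_le. Qed.

Lemma product_frame m k (mu : {finite_measure set 'rV[R]_m -> \bar R})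
    (nu : {finite_measure set 'rV[R]_k -> \bar R}) :
  (0 < m)%N -> (0 < k)%N -> atomless mu -> atomless nu ->
  frame_spectral mu -> frame_spectral nu ->
  exists (A B : R) (L : set ('rV[R]_m * 'rV[R]_k)),
    [/\ 0 < A, A <= B, countable L &
    forall f g, square_integrable mu f -> square_integrable nu g ->
    (A%:E * (sqL2norm mu f + sqL2norm nu g) <=
    \esum_(z in L) (normc (fourier_coef mu f z.1 + fourier_coef nu g z.2) ^+ 2)%:E
    <= B%:E * (sqL2norm mu f + sqL2norm nu g))%E].
Proof.
move=> m0 k0 mu0 nu0 [U [A1 [B1 frU]]] [V [A2 [B2 frV]]].
have [b [binj bo]] := exists_almost_orthogonal nu k0 nu0.
have [a [ainj ao]] := exists_almost_orthogonal mu m0 mu0.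
have [_ A1_gt0 A1B1 _] := frU; have [_ A2_gt0 A2B2 _] := frV.
set Kmu := fine (mu setT) + 4; set Knu := fine (nu setT) + 4.
have Kmu0 : 0 <= Kmu by rewrite addr_ge0// fine_ge0.
have Knu0 : 0 <= Knu by rewrite addr_ge0// fine_ge0.
(* [N] outweighs the Bessel losses: adding the two lower estimates then gives s1 + s2 >= 2 (|f|^2 +
   |g|^2). *)
have [N [N1 N2]] : exists N, 2 * Kmu + 4 <= N%:R * A1 /\ 2 * Knu + 4 <= N%:R * A2.
  near \oo => N; exists N; split.
    by rewrite -ler_pdivrMr//; near: N; exact: nbhs_infty_ger.
  by rewrite -ler_pdivrMr//; near: N; exact: nbhs_infty_ger.
have [L1 [cL1 hL1]] := repeated_frame m k mu nu U A1 B1 b N frU binj bo.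
have [L2 [cL2 hL2]] := repeated_frame k m nu mu V A2 B2 a N frV ainj ao.
pose swap (z : 'rV[R]_k * 'rV[R]_m) := (z.2, z.1).
have swapinj : set_inj L2 swap by move=> [? ?] [? ?] _ _ [-> ->].
(* The two sets may overlap, so the sum over the union is only known to lie between max(s1, s2),
   which is at least (s1 + s2) / 2, and s1 + s2. Hence the lower bound 1; the summand 1 in the upper
   bound secures [A <= B]. *)
exists 1, (1 + 2 * N%:R * B1 + 2 * N%:R * B2 + 2 * Kmu + 2 * Knu), (L1 `|` swap @` L2).
have NB1 : 0 <= N%:R * B1 by rewrite mulr_ge0// ltW// (lt_le_trans A1_gt0).
have NB2 : 0 <= N%:R * B2 by rewrite mulr_ge0// ltW// (lt_le_trans A2_gt0).
split => //; first by lra.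
  rewrite -bigcup2E; apply: bigcup_countable => // -[|[|i]] _ //=.
  exact: countable_image.
move=> f g fint gint.
have [s1 [E1 l1 u1]] := hL1 f g fint gint.
have [s2 [E2 l2 u2]] := hL2 g f gint fint.
rewrite (sqL2normE mu f fint) (sqL2normE nu g gint) -EFinD -!EFinM.
pose H (z : 'rV[R]_m * 'rV[R]_k) :=
  (normc (fourier_coef mu f z.1 + fourier_coef nu g z.2) ^+ 2)%:E.
have H0 z : (0 <= H z)%E by rewrite lee_fin sqr_ge0.
have E2' : (\esum_(z in swap @` L2) H z = s2%:E)%E.
  by rewrite (esum_image L2 swap)// -E2; apply: eq_esum => z _; rewrite /H addrC.
rewrite -/(\esum_(z in L1 `|` swap @` L2) H z)%E.
have := esum_setU_le L1 (swap @` L2) H H0; rewrite E1 E2'.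
have := subset_esum L1 (L1 `|` swap @` L2) H (@subsetUl _ _ _) (fun z _ => H0 z).
have := subset_esum (swap @` L2) (L1 `|` swap @` L2) H (@subsetUr _ _ _) (fun z _ => H0 z).
rewrite E1 E2'; set S := (\esum_(_ in _) _)%E => h2 h1 h12.
have S_fin : S \is a fin_num.
  by rewrite ge0_fin_numE ?(le_lt_trans h12) ?ltry//; exact: esum_ge0.
move: h1 h2 h12; rewrite -(fineK S_fin) -EFinD !lee_fin => h1 h2 h12.
move: l1 u1 l2 u2.
have : 0 <= \int[mu]_x (normc (f x) ^+ 2) by apply: Rintegral_ge0 => x _; exact: sqr_ge0.
have : 0 <= \int[nu]_x (normc (g x) ^+ 2) by apply: Rintegral_ge0 => x _; exact: sqr_ge0.
rewrite -/Kmu -/Knu; set nf := \int[mu]_x _; set ng := \int[nu]_x _.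
move=> ng0 nf0 l1 u1 l2 u2.
have := ler_wpM2r nf0 N1; have := ler_wpM2r ng0 N2.
have p1 := mulr_ge0 NB1 ng0; have p2 := mulr_ge0 NB2 nf0.
have p3 := mulr_ge0 Kmu0 ng0; have p4 := mulr_ge0 Knu0 nf0.
have p5 := mulr_ge0 Kmu0 nf0; have p6 := mulr_ge0 Knu0 ng0.
move=> q1 q2; apply/andP; split; lra.
Unshelve. all: by end_near. Qed.

End product_frame.

(** * Transfer to rho_T *)

Section glued_measure.
Context {d1 d2 d3} {X : measurableType d1} {Y : measurableType d2}
  {Z : measurableType d3} {R : realType}.
Variables (mu : {measure set X -> \bar R}) (nu : {measure set Y -> \bar R})
  (rho : {measure set Z -> \bar R}) (i : X -> Z) (j : Y -> Z).
Hypotheses (mi : measurable_fun setT i) (mj : measurable_fun setT j).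
Hypothesis rhoE : forall E, measurable E -> rho E = (mu (i @^-1` E) + nu (j @^-1` E))%E.

Let mu_i : {measure set Z -> \bar R}.
Proof. by refine (pushforward mu i). Defined.

Let nu_j : {measure set Z -> \bar R}.
Proof. by refine (pushforward nu j). Defined.

(** The integral depends only on the values of [rho] on measurable sets, where it is the sum of two
    image measures. *)
Let integral_glueE (F : Z -> \bar R) :
  (\int[rho]_z F z = \int[measure_add mu_i nu_j]_z F z)%E.
Proof.
apply: eq_measure_integral => E mE _; rewrite rhoE//.
exact: (esym (measure_addE mu_i nu_j E)).
Qed.

Lemma ge0_integral_glue (F : Z -> \bar R) : measurable_fun setT F ->
  (forall z, 0 <= F z)%E ->
  (\int[rho]_z F z = \int[mu]_x F (i x) + \int[nu]_y F (j y))%E.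
Proof.
move=> mF F0; rewrite integral_glueE ge0_integral_measure_add//.
have Ei := @ge0_integral_pushforward _ _ _ _ _ _ mi mu setT F measurableT mF (fun z _ => F0 z).
have Ej := @ge0_integral_pushforward _ _ _ _ _ _ mj nu setT F measurableT mF (fun z _ => F0 z).
by congr (_ + _)%E; [exact: Ei|exact: Ej].
Qed.

Lemma Rintegral_glue (F : Z -> R) : measurable_fun setT F ->
  mu.-integrable setT (EFin \o (fun x => F (i x))) ->
  nu.-integrable setT (EFin \o (fun y => F (j y))) ->
  \int[rho]_z F z = \int[mu]_x F (i x) + \int[nu]_y F (j y).
Proof.
move=> mF imu inu; rewrite /Rintegral integral_glueE.
have mEF : measurable_fun setT (EFin \o F) by exact/measurable_EFinP.
rewrite (@integral_measure_add _ _ _ mu_i nu_j)//.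
- have Ei := @integral_pushforward _ _ _ _ _ _ mi mu setT _ mEF imu measurableT.
  have Ej := @integral_pushforward _ _ _ _ _ _ mj nu setT _ mEF inu measurableT.
  rewrite -fineD; [|exact: integrable_fin_num..].
  by congr (fine (_ + _)%E); [exact: Ei|exact: Ej].
- exact: (@integrable_pushforward _ _ _ _ _ _ mi mu setT _ mEF imu measurableT).
- exact: (@integrable_pushforward _ _ _ _ _ _ mj nu setT _ mEF inu measurableT).
Qed.

End glued_measure.

(** * The measure rho_T as a sum of images of mu and nu *)

Section rho_T_transfer.
Context {R : realType} {m k : nat}.
Variables (mu : {finite_measure set 'rV[R]_m -> \bar R})
  (nu : {finite_measure set 'rV[R]_k -> \bar R})
  (T : {linear 'rV[R]_(m + k) -> 'rV[R]_(m + k)}).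

Definition hembed (x : 'rV[R]_m) : 'rV[R]_(m + k) := row_mx x 0.
Definition vembed (y : 'rV[R]_k) : 'rV[R]_(m + k) := T (row_mx 0 y).

Lemma measurable_hembed : measurable_fun setT hembed.
Proof.
have := measurableT_comp (@measurable_row_pair R m k)
  (measurable_fun_pair (@measurable_id _ 'rV[R]_m setT) (measurable_cst (0 : 'rV[R]_k))).
by [].
Qed.

Lemma measurable_vembed : measurable_fun setT vembed.
Proof.
apply: (measurableT_comp (measurable_linear_rV T)).
have := measurableT_comp (@measurable_row_pair R m k)
  (measurable_fun_pair (measurable_cst (0 : 'rV[R]_m)) (@measurable_id _ 'rV[R]_k setT)).
by [].
Qed.

(** Both products are integrals of the masses of sections. For mu x delta_0 the section at x has
    mass 1 exactly when (x, 0) lies in [E]; for delta_0 x nu the outer integral selects the section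
    at 0. *)
Lemma rho_T_preimage E : measurable E ->
  rho_T mu nu T E = (mu (hembed @^-1` E) + nu (vembed @^-1` E))%E.
Proof.
move=> mE; rewrite /rho_T measure_addE; congr (_ + _)%E.
  transitivity (\int[mu]_x
    (\d_(0%R : 'rV[R]_k) (xsection (row_pair (m:=m) (k:=k) @^-1` E) x)))%E.
    by [].
  have mhE : measurable (hembed @^-1` E).
    by rewrite -[X in measurable X]setTI; exact: measurable_hembed.
  rewrite -[in RHS](setIT (hembed @^-1` E)) -integral_indic//.
  apply: eq_integral => x _; rewrite diracE indicE; congr ((nat_of_bool _)%:R%:E).
  by apply/idP/idP; rewrite /xsection/= !inE /= ?inE.
transitivity (\int[\d_(0%R : 'rV[R]_m)]_x
    nu (xsection (row_pair (m:=m) (k:=k) @^-1` (T @^-1` E)) x))%E.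
  by [].
have mTE : measurable (row_pair (m:=m) (k:=k) @^-1` (T @^-1` E)).
  rewrite -[X in measurable X]setTI; apply: measurable_row_pair => //.
  by rewrite -[X in measurable X]setTI; exact: measurable_linear_rV.
rewrite integral_dirac//; last exact: measurable_fun_xsection.
rewrite diracT mul1e /=; congr (nu _); apply/seteqP; split => y; rewrite /xsection/= inE//.
Qed.

End rho_T_transfer.

(** * Prescribing a frequency on the two subspaces *)

Section rho_T_fourier.
Context {R : realType} {m k : nat}.
Variables (mu : {finite_measure set 'rV[R]_m -> \bar R})
  (nu : {finite_measure set 'rV[R]_k -> \bar R})
  (T : {linear 'rV[R]_(m + k) -> 'rV[R]_(m + k)}).
Hypotheses (Tinj : injective T) (TVH : (T @` vertical) `&` horizontal = [set 0]).

(** With row vectors, the lower blocks [P] and [Q] of the matrix of [T] give the two components of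
    T(0, y). *)
Let P : 'M[R]_(k, m) := dlsubmx (lin1_mx T).
Let Q : 'M[R]_k := drsubmx (lin1_mx T).

Lemma vembedE y : vembed T y = row_mx (y *m P) (y *m Q).
Proof.
by rewrite /vembed -mul_rV_lin1 -[lin1_mx T]submxK mul_row_block !mul0mx !add0r.
Qed.

(** If y Q = 0 then T(0, y) lies both in V and in the horizontal subspace, hence is 0, and y = 0 by
    injectivity of [T]. *)
Lemma transverse_unitmx : Q \in unitmx.
Proof.
rewrite -row_free_unit; apply: inj_row_free => y yQ.
have : ((T @` vertical) `&` horizontal) (T (row_mx 0 y)).
  split; first by exists (row_mx 0 y) => //; exists y.
  by exists (y *m P) => //; rewrite -[RHS]/(vembed T y) vembedE yQ.
rewrite TVH => /=; rewrite -[RHS](linear0 T) => /Tinj.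
by rewrite -row_mx0 => /eq_row_mx[].
Qed.

Lemma dotv_row_mx (a x : 'rV[R]_m) (b y : 'rV[R]_k) :
  dotv (row_mx a b) (row_mx x y) = dotv a x + dotv b y.
Proof.
by rewrite /dotv big_split_ord/=; congr (_ + _); apply: eq_bigr => i _;
  rewrite ?row_mxEl ?row_mxEr.
Qed.

Lemma dotv_mulmx p q (a : 'rV[R]_p) (y : 'rV[R]_q) (M : 'M[R]_(q, p)) :
  dotv a (y *m M) = dotv (a *m M^T) y.
Proof.
have dotE r (u v : 'rV[R]_r) : dotv u v = (u *m v^T) 0 0.
  by rewrite mxE; apply: eq_bigr => i _; rewrite mxE.
by rewrite !dotE trmx_mul mulmxA.
Qed.

(** The solution (u, w) of u P^T + w Q^T = v for z = (u, v): it restricts to u on the horizontal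
    subspace and to v on V. *)
Definition frequency (z : 'rV[R]_m * 'rV[R]_k) : 'rV[R]_(m + k) :=
  row_mx z.1 ((z.2 - z.1 *m P^T) *m invmx Q^T).

Lemma frequency_inj : injective frequency.
Proof.
move=> [a b] [a' b'] /eq_row_mx[/= <-] /(congr1 (mulmx^~ Q^T)).
by rewrite !mulmxKV ?unitmx_tr ?transverse_unitmx// => /addIr ->.
Qed.

Lemma dotv_frequency_hembed z x : dotv (frequency z) (hembed x) = dotv z.1 x.
Proof. by rewrite dotv_row_mx (dotvC _ 0) dotv0l addr0. Qed.

Lemma dotv_frequency_vembed z y : dotv (frequency z) (vembed T y) = dotv z.2 y.
Proof.
rewrite vembedE dotv_row_mx !dotv_mulmx -dotvDl.
by rewrite mulmxKV ?unitmx_tr ?transverse_unitmx// addrC subrK.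
Qed.

Lemma sqL2norm_rho_T f : square_integrable (rho_T mu nu T) f ->
  sqL2norm (rho_T mu nu T) f =
  (sqL2norm mu (f \o hembed) + sqL2norm nu (f \o vembed T))%E.
Proof.
move=> [mRe mIm _].
have := @ge0_integral_glue _ _ _ _ _ _ _ mu nu (rho_T mu nu T) _ _
  (@measurable_hembed R m k) (measurable_vembed T) (rho_T_preimage mu nu T)
  (fun z => (normc (f z) ^+ 2)%:E).
apply; last by move=> z; rewrite lee_fin sqr_ge0.
apply/measurable_EFinP; under eq_fun do rewrite normc_sqr.
by apply: measurable_funD; apply: measurable_funX.
Qed.

Lemma square_integrable_rho_T f : square_integrable (rho_T mu nu T) f ->
  square_integrable mu (f \o hembed) /\ square_integrable nu (f \o vembed T).
Proof.
move=> fint; have := sqL2norm_rho_T f fint; have [mRe mIm fin] := fint.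
have n0 n (r : {finite_measure set 'rV[R]_n -> \bar R}) h : (0 <= sqL2norm r h)%E.
  by apply: integral_ge0 => x _; rewrite lee_fin sqr_ge0.
move=> E; rewrite E in fin; split; split.
- exact: (measurableT_comp mRe (@measurable_hembed R m k)).
- exact: (measurableT_comp mIm (@measurable_hembed R m k)).
- by apply: le_lt_trans fin; rewrite leeDl.
- exact: (measurableT_comp mRe (measurable_vembed T)).
- exact: (measurableT_comp mIm (measurable_vembed T)).
- by apply: le_lt_trans fin; rewrite leeDr.
Qed.

(** The integral against rho_T splits over the two embeddings, along which the phase of
    [frequency z] is that of [z.1] and of [z.2]. *)
Lemma fourier_coef_rho_T f z : square_integrable (rho_T mu nu T) f ->
  fourier_coef (rho_T mu nu T) f (frequency z) =
  fourier_coef mu (f \o hembed) z.1 + fourier_coef nu (f \o vembed T) z.2.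
Proof.
move=> fint; have [hint vint] := square_integrable_rho_T f fint.
have [mRe mIm _] := fint.
have glue := @Rintegral_glue _ _ _ _ _ _ _ mu nu (rho_T mu nu T) _ _
  (@measurable_hembed R m k) (measurable_vembed T) (rho_T_preimage mu nu T).
apply/eqP; rewrite eq_complex; apply/andP; split; apply/eqP => /=.
- rewrite glue.
  + by congr (_ + _); apply: eq_Rintegral => x _ /=;
      rewrite ?dotv_frequency_hembed ?dotv_frequency_vembed.
  + under eq_fun do rewrite Re_mul_cis.
    apply: measurable_funB; apply: measurable_funM => //.
      exact: measurable_cos_dotv.
    exact: measurable_sin_dotv.
  + under eq_fun do rewrite dotv_frequency_hembed.
    exact: (integrable_Re_mul_cis mu _ z.1 hint).
  + under eq_fun do rewrite dotv_frequency_vembed.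
    exact: (integrable_Re_mul_cis nu _ z.2 vint).
- rewrite glue.
  + by congr (_ + _); apply: eq_Rintegral => x _ /=;
      rewrite ?dotv_frequency_hembed ?dotv_frequency_vembed.
  + under eq_fun do rewrite Im_mul_cis.
    apply: measurable_funD; apply: measurable_funM => //.
      exact: measurable_sin_dotv.
    exact: measurable_cos_dotv.
  + under eq_fun do rewrite dotv_frequency_hembed.
    exact: (integrable_Im_mul_cis mu _ z.1 hint).
  + under eq_fun do rewrite dotv_frequency_vembed.
    exact: (integrable_Im_mul_cis nu _ z.2 vint).
Qed.

End rho_T_fourier.

Theorem theorem1p5 (R : realType) (m d : nat) (m_ge1 : (1 <= m)%N)
    (m_lt_d : (m < d)%N)
    (mu : {finite_measure set 'rV[R]_m -> \bar R})
    (nu : {finite_measure set 'rV[R]_(d - m) -> \bar R})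
    (mu_atomless : atomless mu) (nu_atomless : atomless nu)
    (mu_frame : frame_spectral mu) (nu_frame : frame_spectral nu) :
  (forall T : {linear 'rV[R]_(m + (d - m)) -> 'rV[R]_(m + (d - m))},
     bijective T ->
     (T @` vertical) `&` horizontal = [set 0] ->
     frame_spectral (rho_T mu nu T)) /\
  (exists A B : R, [/\ 0 < A, A <= B &
     forall T : {linear 'rV[R]_(m + (d - m)) -> 'rV[R]_(m + (d - m))},
       bijective T ->
       (T @` vertical) `&` horizontal = [set 0] ->
       exists Lambda : set 'rV[R]_(m + (d - m)),
         fourier_frame (rho_T mu nu T) Lambda A B]).
Proof.
have d_gt_m : (0 < d - m)%N by rewrite subn_gt0.
have [A [B [L [A0 AB cL hL]]]] :=
  product_frame m (d - m) mu nu m_ge1 d_gt_m mu_atomless nu_atomless mu_frame nu_frame.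
(* [A], [B] and [L] are fixed before [T] is introduced, which makes the bounds uniform; only the map
   [frequency T] carrying [L] to the spectrum depends on [T]. *)
suff uniform (T : {linear 'rV[R]_(m + (d - m)) -> 'rV[R]_(m + (d - m))}) :
    bijective T -> (T @` vertical) `&` horizontal = [set 0] ->
    exists Lambda, fourier_frame (rho_T mu nu T) Lambda A B.
  split; last by exists A, B.
  by move=> T Tbij TVH; have [Lambda fr] := uniform T Tbij TVH; exists Lambda, A, B.
move=> /bij_inj Tinj TVH; exists (frequency T @` L); split => //.
  exact: countable_image.
move=> f fint; have [hint vint] := square_integrable_rho_T mu nu T f fint.
rewrite (sqL2norm_rho_T mu nu T f fint) (esum_image L (frequency T)); last first.
  by move=> z w _ _; exact: frequency_inj.
under eq_esum => z _ do rewrite fourier_coef_rho_T//.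
exact: hL.
Qed.
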